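(* Let $\mathbb{F}$ be a field of positive characteristic $\ell$, and let $n=p^m$ be a prime power ($p$ prime, $m\ge 1$). Assume $\ell\neq 2,3$ and $\ell\neq p$. If either (1) $p=2$ and $-1$ is a square in $\mathbb{F}$, or (2) $p>2$ and $\mathbb{F}$ contains a primitive $p$th root of unity, then $\mathfrak{sl}_n(\mathbb{F})$ has a classical orthogonal decomposition (COD).
   Context: $\mathfrak{sl}_n(\mathbb{F})$ denotes the Lie algebra of $n\times n$ traceless matrices over $\mathbb{F}$ with bracket $[A,B]=AB-BA$. A Cartan subalgebra of a Lie algebra $\mathfrak{L}$ is a nilpotent subalgebra equal to its own normalizer. A classical Cartan subalgebra of $\mathfrak{L}=\mathfrak{sl}_n(\mathbb{F})$ (with $\ell=\mathrm{char}\,\mathbb{F}$) is an abelian Cartan subalgebra $H$ such that: (a) $\mathfrak{L}=\bigoplus_\alpha \mathfrak{L}_\alpha$, where $\alpha$ ranges over linear functionals on $H$ and $\mathfrak{L}_\alpha=\{x: [x,h]=\alpha(h)x \ \forall h\in H\}$ (the nonzero such $\alpha$ with $\mathfrak{L}_\alpha\ne0$, together with $0$, are the roots); (b) if $\alpha\neq 0$ is a root then $[\mathfrak{L}_\alpha,\mathfrak{L}_{-\alpha}]$ is one-dimensional; (c) if $\alpha,\beta$ are roots with $\beta\neq0$, then not all of $\alpha+k\beta$, $1\le k\le \ell-1$, are roots. The Killing form on $\mathfrak{sl}_n(\mathbb{F})$ is $K(A,B)=\mathrm{Tr}(\mathrm{ad}A\,\mathrm{ad}B)=2n\,\mathrm{Tr}(AB)$.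 A classical orthogonal decomposition (COD) of $\mathfrak{sl}_n(\mathbb{F})$ is a vector space direct sum decomposition $\mathfrak{sl}_n(\mathbb{F})=H_0\oplus H_1\oplus\cdots\oplus H_n$ in which every $H_i$ is a classical Cartan subalgebra and $K(H_i,H_j)=0$ for all $i\neq j$. *)

(* Defs.v *)
From HB Require Import structures.
From mathcomp Require Import all_boot all_order all_algebra.
Set Implicit Arguments. Unset Strict Implicit. Unset Printing Implicit Defensive.
Import GRing.Theory.
Local Open Scope ring_scope.

Section SlLie.
Variables (F : fieldType) (n : nat).

Local Notation M := 'M[F]_n.

Definition lie (A B : M) : M := A *m B - B *m A.

Definition sl : {vspace M} := lker (linfun (fun A : M => (\tr A : F^o))).

(** [U, V] : the subspace spanned by the brackets [u, v], u in U, v in V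
    (spanned by brackets of basis elements, by bilinearity) *)
Definition brk (U V : {vspace M}) : {vspace M} :=
  <<[seq lie u v | u <- vbasis U, v <- vbasis V]>>%VS.

Definition subalgebra (H : {vspace M}) : Prop :=
  (H <= sl)%VS /\ forall x y, x \in H -> y \in H -> lie x y \in H.

Fixpoint lcs (H : {vspace M}) (k : nat) : {vspace M} :=
  if k is k'.+1 then brk H (lcs H k') else H.

Definition nilpotent (H : {vspace M}) : Prop := exists k, lcs H k = 0%VS.

Definition in_normalizer (H : {vspace M}) (x : M) : Prop :=
  x \in sl /\ forall h, h \in H -> lie x h \in H.

Definition self_normalizing (H : {vspace M}) : Prop :=
  forall x, in_normalizer H x <-> x \in H.

Definition cartan (H : {vspace M}) : Prop :=
  [/\ subalgebra H, nilpotent H & self_normalizing H].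

Definition abelian (H : {vspace M}) : Prop :=
  forall x y, x \in H -> y \in H -> lie x y = 0.

Definition functional (H : {vspace M}) := 'Hom(subvs_of H, F^o).

(** weight space L_a = { x in L : [x, h] = a(h) x for all h in H };
    (by linearity in h it suffices to test h on a basis of H) *)
Definition wsp (H : {vspace M}) (a : functional H) : {vspace M} :=
  (sl :&: \bigcap_(i < \dim H)
     lker (linfun (fun x : M =>
       lie x (vbasis H)`_i - (a (vsproj H (vbasis H)`_i) : F) *: x)))%VS.
Arguments wsp : clear implicits.

(** (a): L is the direct sum of the weight spaces L_a, a ranging over all
    linear functionals on H (only finitely many are nonzero). *)
Definition weight_decomp (H : {vspace M}) : Prop :=
  exists s : seq (functional H),
    [/\ uniq s, (\sum_(a <- s) wsp H a)%VS = sl,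
        directv (\sum_(a <- s) wsp H a)
      & forall a, a \notin s -> wsp H a = 0%VS].

Definition is_root (H : {vspace M}) (a : functional H) : bool :=
  (a == 0) || (wsp H a != 0%VS).
Arguments is_root : clear implicits.

(** classical Cartan subalgebra of sl_n(F), where l = char F *)
Definition classical_cartan (l : nat) (H : {vspace M}) : Prop :=
  [/\ cartan H, abelian H, weight_decomp H,
      (forall a, a != 0 -> is_root H a ->
         \dim (brk (wsp H a) (wsp H (- a))) = 1%N)
    & (forall a b, is_root H a -> is_root H b -> b != 0 ->
         ~ (forall k, (1 <= k <= l.-1)%N -> is_root H (a + b *+ k)))].

(** Killing form of sl_n(F): K(A,B) = Tr(ad A ad B) = 2n Tr(AB) *)
Definition killing (A B : M) : F := (2 * n)%:R * \tr (A *m B).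

Definition COD (l : nat) : Prop :=
  exists H : 'I_n.+1 -> {vspace M},
    [/\ forall i, classical_cartan l (H i),
        (\sum_i H i)%VS = sl,
        directv (\sum_i H i)
      & forall i j, i != j -> forall x y, x \in H i -> y \in H j ->
          killing x y = 0].

End SlLie.

(* Main.v *)
(** Index the coordinates of F^n by the finite field K with n = p^m elements,
    and let chi : K -> F^* be a nontrivial additive character. If
    Q_a : K -> F^* satisfies Q_a(x + y) = Q_a(x) Q_a(y) chi(a x y), then the
    bases of columns (Q_a(x) chi(b x))_x, b in K, for a in K, together with the
    standard basis, are mutually unbiased: the rank-one projectors P, P' onto
    vectors of two different bases satisfy Tr(P P') = 1/n, because
    (sum_x g(x)) (sum_x g(x)^-1) = n for g(x) = Q_b(x) Q_a(x)^-1 chi(d x), a <> b.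
    Hence the algebras of traceless matrices diagonal in these n + 1 bases are
    pairwise orthogonal, and they fill sl_n by a dimension count. For odd p
    take Q_a(x) = chi(a x^2 / 2); for p = 2 extend Q_a from a subgroup to a
    larger one by choosing Q_a(e) with Q_a(e)^2 = chi(a e e) = 1 or -1. *)

Require Import Defs.
From HB Require Import structures.
From mathcomp Require Import all_boot all_order all_algebra all_field.
From mathcomp Require Import ring zify.
Set Implicit Arguments. Unset Strict Implicit. Unset Printing Implicit Defensive.
Import GRing.Theory.
Local Open Scope ring_scope.

(** * Bilinearity of the bracket, and membership in [sl], [brk] and [wsp] *)

Section LieLinear.
Variables (F : fieldType) (n : nat).
Local Notation M := 'M[F]_n.
Implicit Types (A B h : M) (U V W : {vspace M}).

Lemma lieDl A B h : lie (A + B) h = lie A h + lie B h.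
Proof. by rewrite /lie mulmxDl mulmxDr opprD addrACA. Qed.

Lemma lieC A B : lie A B = - lie B A.
Proof. by rewrite /lie opprB. Qed.

Lemma lieZl a A h : lie (a *: A) h = a *: lie A h.
Proof. by rewrite /lie -scalemxAl -scalemxAr scalerBr. Qed.

Lemma lieDr A B h : lie h (A + B) = lie h A + lie h B.
Proof. by rewrite lieC lieDl opprD -!(lieC h). Qed.

Lemma lieZr a A h : lie h (a *: A) = a *: lie h A.
Proof. by rewrite lieC lieZl -scalerN -lieC. Qed.

Lemma lie_suml I (r : seq I) (P : pred I) (E : I -> M) h :
  lie (\sum_(i <- r | P i) E i) h = \sum_(i <- r | P i) lie (E i) h.
Proof.
by elim/big_rec2: _ => [|i B A _ <-]; rewrite ?lieDl // /lie mul0mx mulmx0 subrr.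
Qed.

Lemma lie_sumr I (r : seq I) (P : pred I) (E : I -> M) h :
  lie h (\sum_(i <- r | P i) E i) = \sum_(i <- r | P i) lie h (E i).
Proof. by rewrite lieC lie_suml -sumrN; apply: eq_bigr => i _; rewrite -lieC. Qed.

Lemma memv_sl A : (A \in @sl F n) = (\tr A == 0).
Proof.
rewrite /sl memv_ker.
have L : linear (fun A : M => (\tr A : F^o)) by move=> a x y; rewrite linearP.
(* [lfunE] evaluates [linfun] only on a bundled linear map, so the trace is packed as one. *)
pose f := HB.pack_for {linear M -> F^o} (fun A : M => (\tr A : F^o))
  (GRing.isLinear.Build F M F^o *:%R (fun A : M => (\tr A : F^o)) L).
by rewrite (lfunE f).
Qed.

Lemma memv_brk U V A B : A \in U -> B \in V -> lie A B \in brk U V.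
Proof.
move=> UA VB; rewrite (coord_vbasis UA) (coord_vbasis VB) lie_suml.
apply: memv_suml => i _; rewrite lie_sumr; apply: memv_suml => j _.
rewrite lieZl lieZr; do 2!apply: memvZ.
apply/memv_span/allpairsP; exists ((vbasis U)`_i, (vbasis V)`_j).
by rewrite /= !mem_nth ?size_tuple.
Qed.

Lemma brk_subv U V W :
  (forall A B, A \in U -> B \in V -> lie A B \in W) -> (brk U V <= W)%VS.
Proof.
move=> UVW; apply/span_subvP=> _ /allpairsP[[A B] /= [UA VB ->]].
by apply: UVW; apply: vbasis_mem.
Qed.

(** [wsp] tests the weight condition on a basis of [H]; both sides are linear in [h], so it extends
    to all of [H]. *)
Lemma memv_wsp (H : {vspace M}) (a : functional H) A :
  A \in wsp a <-> \tr A = 0 /\ forall h, h \in H -> lie A h = a (vsproj H h) *: A.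
Proof.
rewrite /wsp memv_cap memv_sl.
have E i : (A \in lker (linfun (fun x : M =>
       lie x (vbasis H)`_i - (a (vsproj H (vbasis H)`_i) : F) *: x))) =
   (lie A (vbasis H)`_i == a (vsproj H (vbasis H)`_i) *: A).
  rewrite memv_ker -[RHS]subr_eq0.
  set g := fun x : M => _.
  have L : linear g.
    move=> b x y; rewrite /g lieDl lieZl.
    move: (lie x _) (lie y _) (a _ : F) => X Y c.
    by rewrite scalerBr scalerDr !scalerA [c * b]mulrC opprD addrACA.
  pose f := HB.pack_for {linear M -> M} g (GRing.isLinear.Build F M M *:%R g L).
  by rewrite (lfunE f).
split=> [/andP[/eqP trA /subv_bigcapP HA] | [trA HA]].
  split=> // h Hh.
  rewrite [in RHS](coord_vbasis Hh) {1}(coord_vbasis Hh) lie_sumr.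
  rewrite !linear_sum /= scaler_suml; apply: eq_bigr => i _.
  have := HA i isT; rewrite -memvE E lieZr !linearZ /= => /eqP->; exact: scalerA.
rewrite trA eqxx; apply/subv_bigcapP=> i _; rewrite -memvE E HA //.
by apply/vbasis_mem/mem_nth; rewrite size_tuple.
Qed.

End LieLinear.

(** * The diagonal algebra of a frame is a classical Cartan subalgebra *)

Section FrameCartan.
Variables (F : fieldType) (n : nat) (U V : 'M[F]_n).
Hypothesis VU1 : V *m U = 1%:M.
Hypothesis n_neq0 : n%:R != 0 :> F.
Hypothesis two_neq0 : 2%:R != 0 :> F.
Hypothesis three_neq0 : 3%:R != 0 :> F.

Local Notation M := 'M[F]_n.
Implicit Types (A B X Y h : M) (v w : 'rV[F]_n) (i j k : 'I_n).

(** The matrix of [A] in the basis formed by the columns of [U], whose inverse is [V]. *)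
Definition frame_coord A : M := V *m A *m U.
Definition of_frame X : M := U *m X *m V.
Local Notation c := frame_coord.
Local Notation f := of_frame.

Lemma of_frameK : cancel f c.
Proof.
by move=> X; rewrite /c /f !mulmxA VU1 mul1mx -mulmxA VU1 mulmx1.
Qed.

Lemma frame_coordK : cancel c f.
Proof.
have UV1 := mulmx1C VU1.
by move=> X; rewrite /c /f !mulmxA UV1 mul1mx -mulmxA UV1 mulmx1.
Qed.

Lemma frame_coord_is_linear : linear c.
Proof. by move=> a A B; rewrite /c mulmxDr mulmxDl -scalemxAr -scalemxAl. Qed.

HB.instance Definition _ :=
  GRing.isLinear.Build F M M *:%R c frame_coord_is_linear.

Lemma of_frame_is_linear : linear f.
Proof. by move=> a A B; rewrite /f mulmxDr mulmxDl -scalemxAr -scalemxAl. Qed.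

HB.instance Definition _ := GRing.isLinear.Build F M M *:%R f of_frame_is_linear.

Lemma mxtrace_of_frame X : \tr (f X) = \tr X.
Proof. by rewrite /f mxtrace_mulC mulmxA VU1 mul1mx. Qed.

Lemma mxtrace_frame_coord A : \tr (c A) = \tr A.
Proof. by rewrite -{2}[A]frame_coordK mxtrace_of_frame. Qed.

Lemma mulmx_of_frame X Y : f X *m f Y = f (X *m Y).
Proof. by rewrite /f !mulmxA -(mulmxA (U *m X)) VU1 mulmx1. Qed.

Lemma lie_of_frame X Y : lie (f X) (f Y) = f (lie X Y).
Proof. by rewrite /lie !mulmx_of_frame linearB. Qed.

Lemma lie_diag_mx X v i j : lie X (diag_mx v) i j = X i j * (v 0 j - v 0 i).
Proof. by rewrite /lie mul_mx_diag mul_diag_mx !mxE mulrBr (mulrC (X i j) (v 0 i)). Qed.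

Definition frame_cartan : {vspace M} :=
  (limg (linfun (f \o @diag_mx F n)) :&: @sl F n)%VS.
Local Notation H := frame_cartan.

Lemma frame_cartanP h :
  reflect (exists2 v, h = f (diag_mx v) & \sum_k v 0 k = 0) (h \in H).
Proof.
rewrite memv_cap memv_sl; apply: (iffP andP) => [[/memv_imgP[v _ ->]] | [v -> v0]].
  by rewrite lfunE /= mxtrace_of_frame mxtrace_diag => /eqP v0; exists v.
rewrite mxtrace_of_frame mxtrace_diag v0 eqxx; split=> //.
by apply/memv_imgP; exists v; rewrite ?memvf // lfunE.
Qed.

(** Rank-nullity twice: the diagonal embedding is injective, and the trace takes values in a line,
    so passing to its kernel costs at most one dimension. *)
Lemma dim_frame_cartan : (n <= (\dim H).+1)%N.
Proof.
set D := (limg (linfun (f \o @diag_mx F n)))%VS.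
have dimD : \dim D = n.
  have := limg_ker_dim (linfun (f \o @diag_mx F n)) fullv.
  rewrite capfv dimvf /dim /= mul1n -/D.
  suff /eqP-> : lker (linfun (f \o @diag_mx F n)) == 0%VS by rewrite dimv0.
  apply/lker0P=> v w; rewrite !lfunE /= => /(can_inj of_frameK) /matrixP vw.
  by apply/rowP=> k; have := vw k k; rewrite !mxE eqxx.
have := limg_ker_dim (linfun (fun A : M => (\tr A : F^o))) D.
rewrite -/(@sl F n) -/H dimD => {1}<-; rewrite -addn1 leq_add2l.
by rewrite (leq_trans (dimvS (subvf _))) // dimvf.
Qed.

Lemma abelian_frame_cartan : abelian H.
Proof.
move=> _ _ /frame_cartanP[v -> _] /frame_cartanP[w -> _].
rewrite lie_of_frame; apply/(can_inj frame_coordK); rewrite of_frameK linear0.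
apply/matrixP=> i j; rewrite lie_diag_mx !mxE.
by case: eqVneq => [->|]; rewrite ?subrr ?mulr0 // mulr0n mul0r.
Qed.

(** n E_kk - 1 is traceless, unlike E_kk, and still isolates the k-th diagonal
    coordinate up to the invertible factor n. *)
Definition cartan_probe k : M := f (diag_mx (\row_j (n%:R * (j == k)%:R - 1))).

Lemma cartan_probe_in k : cartan_probe k \in H.
Proof.
apply/frame_cartanP; exists (\row_j (n%:R * (j == k)%:R - 1)) => //.
under eq_bigr do rewrite mxE.
rewrite sumrB -mulr_sumr (bigD1 k) //= eqxx big1 => [|i /negPf->] //.
by rewrite addr0 mulr1 sumr_const card_ord subrr.
Qed.

Lemma lie_cartan_probe A k i j :
  c (lie A (cartan_probe k)) i j = n%:R * ((j == k)%:R - (i == k)%:R) * c A i j.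
Proof.
rewrite -{1}[A]frame_coordK lie_of_frame of_frameK lie_diag_mx !mxE.
by rewrite mulrC; congr (_ * _); ring.
Qed.

Lemma cartan_frame_cartan : cartan H.
Proof.
have HH := abelian_frame_cartan; split.
- split=> [|A B HA HB]; first exact: capvSr.
  by rewrite HH ?mem0v.
- exists 1%N; apply/eqP; rewrite -subv0; apply: brk_subv => A B HA HB.
  by rewrite HH ?mem0v.
move=> A; split=> [[slA NA] | HA].
  apply/frame_cartanP; exists (\row_k c A k k).
    rewrite -[LHS]frame_coordK; congr f; apply/matrixP=> i j.
    rewrite [RHS]mxE [in RHS]mxE.
    case: eqVneq => [->|ij]; rewrite ?mulr1n // mulr0n.
    (* Bracketing with the probe at [j] multiplies the entry [(i, j)] by [n], yet the result must be
       diagonal; hence this entry is 0. *)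
    have /frame_cartanP[v Ev _] := NA _ (cartan_probe_in j).
    have := lie_cartan_probe A j i j.
    rewrite Ev of_frameK mxE (negPf ij) mulr0n eqxx subr0 mulr1.
    by move/esym/eqP; rewrite mulf_eq0 (negPf n_neq0) => /eqP.
  move: slA; rewrite memv_sl -mxtrace_frame_coord => /eqP tr0.
  by rewrite -[RHS]tr0; apply: eq_bigr => i _; rewrite mxE.
split; first by move: HA; rewrite memv_cap => /andP[].
by move=> h Hh; rewrite HH ?mem0v.
Qed.

Fact frame_root_is_linear i j :
  linear (fun h : subvs_of H => c (vsval h) j j - c (vsval h) i i : F^o).
Proof.
move=> a x y; rewrite !linearP /= !mxE scalerBr /GRing.scale /=; ring.
Qed.

Definition frame_root i j : functional H :=
  linfun (HB.pack_for {linear subvs_of H -> F^o}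
    (fun h : subvs_of H => c (vsval h) j j - c (vsval h) i i : F^o)
    (GRing.isLinear.Build _ _ _ _ _ (frame_root_is_linear i j))).
Local Notation rt := frame_root.

Lemma frame_rootE i j h : h \in H -> rt i j (vsproj H h) = c h j j - c h i i.
Proof. by move=> Hh; rewrite lfunE /= vsprojK. Qed.

Lemma frame_root_probe i j k :
  rt i j (vsproj H (cartan_probe k)) = n%:R * ((j == k)%:R - (i == k)%:R).
Proof.
rewrite frame_rootE ?cartan_probe_in // of_frameK !mxE !eqxx !mulr1n; ring.
Qed.

(** Writing [e_k] for the k-th diagonal coordinate, this reads off the coefficient of [e_k] in a
    root [e_j - e_i], even though the [e_k] sum to zero on [H]. *)
Definition root_coef (a : functional H) k : F := a (vsproj H (cartan_probe k)) / n%:R.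

Lemma root_coef_frame_root i j k : root_coef (rt i j) k = (j == k)%:R - (i == k)%:R.
Proof. by rewrite /root_coef frame_root_probe mulrC mulKf. Qed.

Lemma root_coefD a b k : root_coef (a + b) k = root_coef a k + root_coef b k.
Proof. by rewrite /root_coef add_lfunE mulrDl. Qed.

Lemma root_coefMn a r k : root_coef (a *+ r) k = root_coef a k *+ r.
Proof.
by elim: r => [|r IH]; rewrite ?mulr0n ?mulrS ?root_coefD ?IH // /root_coef zero_lfunE mul0r.
Qed.

Lemma frame_root0 i : rt i i = 0.
Proof. by apply/lfunP=> h; rewrite lfunE /= subrr zero_lfunE. Qed.

Lemma frame_rootN i j : - rt i j = rt j i.
Proof. by apply/lfunP=> h; rewrite opp_lfunE !lfunE /= opprB. Qed.

Lemma neg1_neq1 : (-1 == 1 :> F) = false.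
Proof. by rewrite eq_sym -addr_eq0 (negPf two_neq0). Qed.

(** The coefficient is 1 only at [j] and -1 only at [i]; as 2 is nonzero these values differ, so the
    root determines both indices. *)
Lemma frame_root_inj i j i' j' : i != j -> rt i j = rt i' j' -> i = i' /\ j = j'.
Proof.
move=> ij E; have Ec k : (j == k)%:R - (i == k)%:R = (j' == k)%:R - (i' == k)%:R :> F.
  by rewrite -!root_coef_frame_root E.
have pos (a b : bool) : a%:R - b%:R = 1 :> F -> a.
  case: a b => [] [] // /eqP; first by rewrite sub0r neg1_neq1.
  by rewrite subr0 eq_sym oner_eq0.
split; apply/esym/eqP; last first.
  by apply: (pos _ (i' == j)); rewrite -Ec eqxx (negPf ij) subr0.
apply: (pos _ (j' == i)).
by rewrite -opprB -Ec eqxx eq_sym (negPf ij) sub0r opprK.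
Qed.

(** Bracketing with a diagonal matrix [v] scales the entry [(i, j)] by [v_j - v_i], so every nonzero
    entry of a weight vector pins down its weight. Weight conditions thus become conditions on the
    support. *)
Lemma memv_wsp_frame a A :
  A \in wsp a <-> \tr A = 0 /\ forall i j, c A i j != 0 -> a = rt i j.
Proof.
rewrite memv_wsp; split=> [] [trA HA]; split=> //.
  move=> i j cA; apply/lfunP=> h; rewrite -(vsvalK h).
  move: (vsval h) (subvsP h) => {}h Hh; rewrite frame_rootE //; have := HA h Hh.
  case/frame_cartanP: Hh => v -> _.
  rewrite -{1}[A]frame_coordK lie_of_frame => /(congr1 c)/matrixP/(_ i j).
  rewrite !of_frameK lie_diag_mx linearZ /= [in RHS]mxE mulrC => /(mulIf cA) <-.
  by rewrite !mxE !eqxx.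
move=> _ /frame_cartanP[v -> v0].
have Hv : f (diag_mx v) \in H by apply/frame_cartanP; exists v.
apply/(can_inj frame_coordK)/matrixP=> i j.
rewrite -{1}[A]frame_coordK lie_of_frame of_frameK lie_diag_mx linearZ /= [RHS]mxE.
have [->|cA] := eqVneq (c A i j) 0; first by rewrite mul0r mulr0.
by rewrite (HA i j cA) frame_rootE // of_frameK !mxE !eqxx !mulr1n mulrC.
Qed.

Lemma delta_in_wsp i j : i != j -> f (delta_mx i j) \in wsp (rt i j).
Proof.
move=> ij; apply/memv_wsp_frame; split.
  rewrite mxtrace_of_frame; apply: big1 => k _; rewrite mxE.
  by case: eqP => // ->; rewrite (negPf ij).
move=> i' j'; rewrite of_frameK mxE; case: andP => [[/eqP-> /eqP->]|] //.
by rewrite eqxx.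
Qed.

Lemma of_frame_delta_neq0 i j : f (delta_mx i j) != 0.
Proof.
apply/eqP=> /(congr1 c)/matrixP/(_ i j)/eqP.
by rewrite of_frameK linear0 !mxE !eqxx oner_eq0.
Qed.

Lemma is_root_frameP (a : functional H) :
  is_root a -> exists i j, a = rt i j.
Proof.
case/orP=> [/eqP->|].
  have n0 : (0 < n)%N by rewrite lt0n; apply: contraNneq n_neq0 => ->.
  by exists (Ordinal n0), (Ordinal n0); rewrite frame_root0.
rewrite -vpick0; set A := vpick _ => An0.
have /memv_wsp_frame[_ HA] := memv_pick (wsp a).
have /existsP[i /existsP[j ij]] : [exists i, exists j, c A i j != 0].
  apply: contraR An0 => /existsPn cA0; apply/eqP/(can_inj frame_coordK).
  rewrite linear0; apply/matrixP=> i j; rewrite [RHS]mxE; apply/eqP.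
  by have /existsPn/(_ j) := cA0 i; rewrite negbK.
by exists i, j; apply: HA.
Qed.

Lemma wsp_frame_root i j : i != j -> wsp (rt i j) = <[f (delta_mx i j)]>%VS.
Proof.
move=> ij; apply/eqP; rewrite eqEsubv -memvE delta_in_wsp // andbT.
apply/subvP=> A /memv_wsp_frame[_ HA]; apply/vlineP; exists (c A i j).
apply/(can_inj frame_coordK)/matrixP=> i' j'; rewrite linearZ /= of_frameK [RHS]mxE [delta_mx _ _ _ _]mxE.
have [//|cA] := eqVneq (c A i' j') 0; last first.
  by have [<- <-] := frame_root_inj ij (HA _ _ cA); rewrite !eqxx mulr1.
case: andP => [[/eqP-> /eqP->] ->|_ ->]; by rewrite ?mul0r ?mulr0.
Qed.

Lemma dim_brk_frame_root i j : i != j -> \dim (brk (wsp (rt i j)) (wsp (rt j i))) = 1%N.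
Proof.
move=> ij; set E := lie (f (delta_mx i j)) (f (delta_mx j i)).
have -> : brk (wsp (rt i j)) (wsp (rt j i)) = <[E]>%VS.
  have ji : j != i by rewrite eq_sym.
  rewrite !wsp_frame_root //; apply/eqP; rewrite eqEsubv -memvE.
  rewrite memv_brk ?memv_line // andbT; apply: brk_subv => _ _ /vlineP[a ->] /vlineP[b ->].
  by rewrite lieZl lieZr !memvZ ?memv_line.
rewrite dim_vline; apply/eqP; rewrite eqb1; apply/eqP.
(* In frame coordinates [E] is the difference of the diagonal units at [i] and [j], with entry 1 at
   [(i, i)]. *)
rewrite /E lie_of_frame => /(congr1 c)/matrixP/(_ i i)/eqP.
rewrite of_frameK linear0 /lie !mul_delta_mx !mxE !eqxx (negPf ij) subr0.
by rewrite oner_eq0.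
Qed.

(** In frame coordinates a matrix is its diagonal part, of weight zero, plus multiples of
    off-diagonal units, each a root vector. The sum is direct because a given entry can be nonzero
    in one weight space only. *)
Lemma weight_decomp_frame : weight_decomp H.
Proof.
(* All the [rt i i] equal the zero functional, so duplicates must be removed. *)
pose s := undup [seq rt i j | i <- enum 'I_n, j <- enum 'I_n].
have s_rt i j : rt i j \in s.
  by rewrite mem_undup; apply/allpairsP; exists (i, j); rewrite /= !mem_enum.
have us : uniq s by apply: undup_uniq.
exists s; split=> //.
- apply/eqP; rewrite eqEsubv; apply/andP; split.
    by rewrite big_tnth; apply/subv_sumP=> i _; apply: capvSl.
  apply/subvP=> A; rewrite memv_sl => /eqP trA.
  have wsp_sum a B : a \in s -> B \in wsp a -> B \in (\sum_(b <- s) wsp b)%VS.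
    move=> sa Ba; rewrite (bigD1_seq a) //=.
    by apply: (subvP (addvSl _ _)).
  have cE : c A = diag_mx (\row_k c A k k) +
                 \sum_i \sum_(j | j != i) c A i j *: delta_mx i j.
    rewrite {1}[c A]matrix_sum_delta diag_mx_sum_delta -big_split.
    apply: eq_bigr => k _; rewrite (bigD1 k) //=; congr (_ *: _ + _).
    by rewrite [RHS]mxE.
  rewrite -[A]frame_coordK cE linearD; apply: memvD.
    case: (pickP 'I_n) => [k _ | n0]; last first.
      rewrite [diag_mx _](_ : _ = 0) ?linear0 ?mem0v //.
      by apply/matrixP=> k; have := n0 k.
    apply: (wsp_sum _ _ (s_rt k k)); apply/memv_wsp_frame; split.
      rewrite mxtrace_of_frame mxtrace_diag -[RHS]trA -mxtrace_frame_coord.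
      by apply: eq_bigr => k' _; rewrite mxE.
    move=> i j; rewrite of_frameK [diag_mx _ _ _]mxE.
    by case: (i =P j) => [->|]; rewrite ?mulr0n ?eqxx ?frame_root0.
  rewrite !linear_sum; apply: memv_suml => i _.
  rewrite linear_sum; apply: memv_suml => j ji.
  rewrite linearZ; apply: memvZ; apply: (wsp_sum _ _ (s_rt i j)).
  by apply: delta_in_wsp; rewrite eq_sym.
(* Indexing by positions in [s] gives a finite family, to which the independence criterion
   applies. *)
- suff D : directv (\sum_(i < size s) wsp (tnth (in_tuple s) i)).
    move: D; rewrite !directvE /=.
    by rewrite [in X in _ -> X]big_tnth [X in _ -> _ == X]big_tnth.
  apply/directv_sum_independent => As As_in As0 a _.
  apply/(can_inj frame_coordK); rewrite linear0; apply/matrixP=> i j.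
  rewrite [RHS]mxE; apply/eqP; apply/negPn/negP=> ca.
  have root_us b : c (As b) i j != 0 -> tnth (in_tuple s) b = rt i j.
    by have /memv_wsp_frame[_] := As_in b isT; apply.
  have /eqP := congr1 (fun A => c A i j) As0.
  rewrite linear_sum summxE linear0 [X in _ == X]mxE.
  rewrite (bigD1 a) //= big1 ?addr0 ?(negPf ca) // => b ba.
  apply/eqP; apply: contraNT ba => /root_us; rewrite -(root_us a ca).
  by move/(tuple_uniqP (in_tuple s) us) => ->.
move=> a sa; apply/eqP; apply: contraNT sa => wa.
have [|i [j ->]] := @is_root_frameP a; last exact: s_rt.
by rewrite /is_root wa orbT.
Qed.

Lemma root_coef_root a k : is_root a -> root_coef a k \in [:: 0; 1; -1].
Proof.
case/is_root_frameP=> i [j ->]; rewrite root_coef_frame_root !inE.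
by case: (j == k) (i == k) => [] []; rewrite ?subrr ?subr0 ?sub0r !eqxx ?orbT.
Qed.

(** Some coefficient of a nonzero root [b] is 1; along the string [a + k b] it
    takes the value 2 for some k in {1, 2, 3}. *)
Lemma frame_root_string l (a b : functional H) :
  (3 < l)%N -> is_root a -> is_root b -> b != 0 ->
  ~ (forall r, (1 <= r <= l.-1)%N -> is_root (a + b *+ r)).
Proof.
move=> l3 ra /is_root_frameP[i [j ->]] ij abr.
have {}ij : i != j by apply: contraNneq ij => ->; rewrite frame_root0.
(* Root coefficients lie in {0, 1, -1}, and 2 is none of these since 1, 2 and 3 are nonzero in
   [F]. *)
have no2 r : (1 <= r <= 3)%N -> root_coef a j + r%:R != 2%:R.
  move=> /andP[r1 r3]; have /abr/(root_coef_root j) : (1 <= r <= l.-1)%N.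
    by rewrite r1 -ltnS prednK ?(leq_ltn_trans r3) // (leq_trans _ l3).
  rewrite root_coefD root_coefMn root_coef_frame_root eqxx (negPf ij) subr0.
  apply: contraTneq => ->; rewrite !inE (negPf two_neq0) -(subr_eq0 2%:R 1).
  by rewrite -(addr_eq0 2%:R 1) -{1}natr1 addrK oner_eq0 natr1 (negPf three_neq0).
(* Starting from 0, 1 or -1, the value 2 is reached after 2, 1 or 3 steps respectively. *)
have := root_coef_root j ra; rewrite !inE => /or3P[] /eqP Ea.
- by have := no2 2%N isT; rewrite Ea add0r eqxx.
- by have := no2 1%N isT; rewrite Ea eqxx.
by have := no2 3%N isT; rewrite Ea -natr1 addrC addrK eqxx.
Qed.

Lemma classical_cartan_frame l : (3 < l)%N -> classical_cartan l H.
Proof.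
move=> l3; split.
- exact: cartan_frame_cartan.
- exact: abelian_frame_cartan.
- exact: weight_decomp_frame.
- move=> a a0 /is_root_frameP[i [j Ea]]; rewrite Ea frame_rootN dim_brk_frame_root //.
  by apply: contraNneq a0 => ij; rewrite Ea ij frame_root0.
by move=> a b ra rb b0; apply: frame_root_string.
Qed.

(** Pairing a traceless diagonal [v] with the k-th probe gives [n * v_k]. This is what turns
    orthogonality of the algebras into linear independence. *)
Lemma frame_cartan_trace_nondegenerate h :
  h \in H -> (forall h', h' \in H -> \tr (h *m h') = 0) -> h = 0.
Proof.
case/frame_cartanP=> v -> v0 orth; rewrite [diag_mx v](_ : _ = 0) ?linear0 //.
apply/matrixP=> k j; rewrite !mxE; case: eqVneq => _; rewrite ?mulr0n // mulr1n.
have := orth _ (cartan_probe_in k); rewrite mulmx_of_frame mxtrace_of_frame.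
rewrite mulmx_diag mxtrace_diag; under eq_bigr do rewrite !mxE mulrBr mulr1.
rewrite sumrB v0 subr0 (bigD1 k) //= eqxx big1 => [|j' /negPf->]; last by rewrite !mulr0.
by rewrite mulr1 addr0 => /eqP; rewrite mulf_eq0 (negPf n_neq0) orbF => /eqP.
Qed.

End FrameCartan.

(** * From mutually unbiased frames to an orthogonal decomposition *)

Section UnbiasedBases.
Variables (F : fieldType) (n l : nat) (U V : 'I_n.+1 -> 'M[F]_n).
Hypothesis VU1 : forall i, V i *m U i = 1%:M.
Hypothesis n_neq0 : n%:R != 0 :> F.
Hypothesis two_neq0 : 2%:R != 0 :> F.
Hypothesis three_neq0 : 3%:R != 0 :> F.
Hypothesis l_gt3 : (3 < l)%N.
(** The product is the trace of the product of two projectors, each a column of [U] times the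
    matching row of [V]; no complex conjugation is involved. *)
Hypothesis unbiased : forall i i', i != i' -> forall k k',
  (V i *m U i') k k' * (V i' *m U i) k' k = n%:R^-1.

(** The trace factors as [n^-1] times the sum of [v] times the sum of [w], and both sums vanish. *)
Lemma mxtrace_unbiased i i' x y : i != i' ->
  x \in frame_cartan (U i) (V i) -> y \in frame_cartan (U i') (V i') ->
  \tr (x *m y) = 0.
Proof.
move=> ii' /(frame_cartanP (VU1 i))[v -> v0] /(frame_cartanP (VU1 i'))[w -> w0].
rewrite /of_frame -!mulmxA mxtrace_mulC -!mulmxA.
rewrite !mulmxA -(mulmxA _ (V i) (U i')) -(mulmxA _ (V i') (U i)).
rewrite (_ : \tr _ = \sum_k \sum_k' n%:R^-1 * (v 0 k * w 0 k')).
  under eq_bigr do rewrite -mulr_sumr -mulr_sumr w0 !mulr0.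
  by rewrite big1.
apply: eq_bigr => k _; rewrite -mulmxA mxE; apply: eq_bigr => k' _.
by rewrite !mul_diag_mx [X in X * _]mxE [X in _ * X]mxE -(unbiased ii' k k'); ring.
Qed.

(** The identity has trace [n], which is nonzero, so [sl] is a proper subspace. *)
Lemma dim_sl : (0 < n)%N -> (\dim (@sl F n) <= (n * n).-1)%N.
Proof.
move=> n0; have ltf : (\dim (@sl F n) < \dim (fullv : {vspace 'M[F]_n}))%N.
  rewrite ltn_neqAle dimvS ?subvf // andbT; apply/eqP=> E.
  have /eqP slf : @sl F n == fullv by rewrite eqEdim subvf E leqnn.
  have : (1%:M : 'M[F]_n) \in @sl F n by rewrite slf memvf.
  by rewrite memv_sl mxtrace1 (negPf n_neq0).
by rewrite -ltnS prednK ?muln_gt0 ?n0 // (leq_trans ltf) // dimvf.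
Qed.

Lemma COD_of_unbiased : COD F n l.
Proof.
have n0 : (0 < n)%N by rewrite lt0n; apply: contraNneq n_neq0 => ->.
pose H i := frame_cartan (U i) (V i); exists H.
(* Tracing a vanishing sum against [H i] kills all other terms; nondegeneracy on [H i] then kills
   the i-th. *)
have dH : directv (\sum_i H i).
  apply/directv_sum_independent => x xH x0 i _.
  apply: (frame_cartan_trace_nondegenerate (VU1 i) n_neq0 (xH i isT)) => y yH.
  have := congr1 (fun A => \tr (A *m y)) x0; rewrite mul0mx mxtrace0 mulmx_suml.
  rewrite linear_sum (bigD1 i) //= big1 ?addr0 // => j ji.
  exact: (mxtrace_unbiased ji (xH j isT) yH).
split=> //.
- by move=> i; apply: classical_cartan_frame.
- apply/eqP; rewrite eqEdim; apply/andP; split.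
    by apply/subv_sumP=> i _; apply: capvSr.
  rewrite (directvP dH) /= (leq_trans (dim_sl n0)) //.
  (* The count is [(n + 1) * (n - 1) = n * n - 1]. *)
  apply: (@leq_trans (\sum_(i < n.+1) n.-1)); last first.
    by apply: leq_sum => i _; rewrite -ltnS prednK // dim_frame_cartan.
  by rewrite sum_nat_const card_ord; case: n n0 => // k _; rewrite /= mulSn mulnSr; lia.
by move=> i j ij x y xH yH; rewrite /killing (mxtrace_unbiased ij) ?mulr0.
Qed.

End UnbiasedBases.

(** * Gauss sums and the unbiased bases made from quadratic functions *)

Section GaussSums.
Variables (F : fieldType) (K : finFieldType) (chi : K -> F).
Hypothesis chi0 : chi 0 = 1.
Hypothesis chiD : forall x y, chi (x + y) = chi x * chi y.
Hypothesis chi_nontrivial : exists x, chi x != 1.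

Lemma additive_char_neq0 x : chi x != 0.
Proof.
apply/eqP=> cx; have /eqP := chi0; rewrite -(subrr x) chiD cx mul0r.
by rewrite eq_sym oner_eq0.
Qed.

Lemma additive_charN x : chi (- x) = (chi x)^-1.
Proof.
apply: (mulfI (additive_char_neq0 x)).
by rewrite -chiD subrr chi0 divff ?additive_char_neq0.
Qed.

(** For nonzero [a], translating the variable by [y / a] multiplies the sum by [chi y], chosen
    different from 1. *)
Lemma sum_additive_char a : \sum_x chi (a * x) = if a == 0 then #|K|%:R else 0.
Proof.
case: eqVneq => [->|a0].
  by under eq_bigr do rewrite mul0r chi0; rewrite sumr_const.
have [y cy] := chi_nontrivial; apply/eqP.
have: (chi y - 1) * \sum_x chi (a * x) == 0; last first.
  by rewrite mulf_eq0 subr_eq0 (negPf cy).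
rewrite mulrBl mul1r subr_eq0 mulr_sumr; apply/eqP.
rewrite [RHS](reindex_inj (addrI (y / a))) /=; apply: eq_bigr => x _.
by rewrite mulrDr chiD mulrCA divff // mulr1.
Qed.

(** An algebraic form of the squared modulus of a Gauss sum. Replacing [x] by [x + y] turns
    [g x / g y] into [g x * chi (a * x * y)], and summing over [y] leaves only [x = 0]. *)
Lemma gauss_sum_norm (g : K -> F) a :
  (forall x, g x != 0) -> a != 0 ->
  (forall x y, g (x + y) = g x * g y * chi (a * x * y)) ->
  (\sum_x g x) * (\sum_x (g x)^-1) = #|K|%:R.
Proof.
move=> g_neq0 a0 gD.
have g0 : g 0 = 1.
  apply: (mulfI (g_neq0 0)); have := gD 0 0.
  by rewrite addr0 mulr0 chi0 !mulr1 => <-.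
rewrite mulr_sumr (eq_bigr (fun y => \sum_x g x * chi (a * x * y))); last first.
  move=> y _; rewrite mulr_suml (reindex_inj (addIr y)) /=.
  by apply: eq_bigr => x _; rewrite gD mulrAC mulfK.
rewrite exchange_big /= (bigD1 0) //= -mulr_sumr sum_additive_char mulr0 eqxx.
rewrite g0 mul1r big1 ?addr0 // => x x0.
by rewrite -mulr_sumr sum_additive_char mulf_eq0 (negPf a0) (negPf x0) mulr0.
Qed.

Variable Q : K -> K -> F.
Hypothesis Q_neq0 : forall a x, Q a x != 0.
Hypothesis QD : forall a x y, Q a (x + y) = Q a x * Q a y * chi (a * x * y).
Hypothesis card_neq0 : #|K|%:R != 0 :> F.

Local Notation q := #|K|.

Lemma sum_enum_val (f : K -> F) : \sum_(i < q) f (enum_val i) = \sum_x f x.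
Proof. by rewrite -big_enum_val. Qed.

Definition quad_basis a : 'M[F]_q :=
  \matrix_(i, j) (Q a (enum_val i) * chi (enum_val j * enum_val i)).

(** The transposed entrywise inverse of [quad_basis a], divided by [q]; it stands in for the
    conjugate transpose. *)
Definition quad_dual a : 'M[F]_q :=
  \matrix_(j, i) (q%:R^-1 * ((Q a (enum_val i))^-1 * chi (- (enum_val j * enum_val i)))).

Lemma mul_quad_dual_basis a b j j' :
  (quad_dual a *m quad_basis b) j j' =
  q%:R^-1 * \sum_x Q b x / Q a x * chi ((enum_val j' - enum_val j) * x).
Proof.
rewrite mxE mulr_sumr -sum_enum_val; apply: eq_bigr => i _; rewrite !mxE.
by rewrite mulrBl chiD; ring.
Qed.

Lemma quad_dual_basisK a : quad_dual a *m quad_basis a = 1%:M.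
Proof.
apply/matrixP=> j j'; rewrite mul_quad_dual_basis mxE.
under eq_bigr do rewrite divff // mul1r.
rewrite sum_additive_char subr_eq0 (inj_eq enum_val_inj) eq_sym.
by case: eqP => _; rewrite ?mulr0 // mulVf.
Qed.

Definition mub_basis (i : 'I_q.+1) : 'M[F]_q :=
  if unlift ord0 i is Some a then quad_basis (enum_val a) else 1%:M.

Definition mub_dual (i : 'I_q.+1) : 'M[F]_q :=
  if unlift ord0 i is Some a then quad_dual (enum_val a) else 1%:M.

Lemma mub_dualK i : mub_dual i *m mub_basis i = 1%:M.
Proof.
rewrite /mub_dual /mub_basis; case: (unlift ord0 i) => [a|]; last exact: mul1mx.
exact: quad_dual_basisK.
Qed.

Lemma quad_basis_dual_entries a i j :
  quad_basis a i j * quad_dual a j i = q%:R^-1.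
Proof.
rewrite !mxE additive_charN mulrCA -invfM.
by rewrite divff ?mulr1 // mulf_neq0 // additive_char_neq0.
Qed.

Lemma mub_unbiased i i' : i != i' -> forall k k',
  (mub_dual i *m mub_basis i') k k' * (mub_dual i' *m mub_basis i) k' k = q%:R^-1.
Proof.
move=> ii' k k'; rewrite /mub_dual /mub_basis.
case: (unliftP ord0 i) ii' => [a ->|->]; case: (unliftP ord0 i') => [b ->|->] ab.
- rewrite !mul_quad_dual_basis; set d := enum_val k' - _.
  have ba0 : enum_val b - enum_val a != 0.
    rewrite subr_eq0 (inj_eq enum_val_inj) eq_sym.
    by apply: contraNneq ab => ->.
  (* The two matrix entries are [q^-1] times the sum of [g] and [q^-1] times the sum of its
     inverses; [g] obeys the quadratic law with the nonzero parameter [b - a]. *)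
  pose g x := Q (enum_val b) x / Q (enum_val a) x * chi (d * x).
  have g_neq0 x : g x != 0.
    by rewrite !mulf_neq0 ?invr_eq0 // additive_char_neq0.
  have gD x y : g (x + y) = g x * g y * chi ((enum_val b - enum_val a) * x * y).
    have -> : (enum_val b - enum_val a) * x * y =
              enum_val b * x * y - enum_val a * x * y by ring.
    rewrite /g !QD mulrDr !chiD additive_charN.
    move: (chi (enum_val a * x * y)) (additive_char_neq0 (enum_val a * x * y)) => u u0.
    by field; rewrite !Q_neq0 u0.
  rewrite [X in _ * (_ * X)](eq_bigr (fun x => (g x)^-1)); last first.
    move=> x _; rewrite /g -[enum_val k - _]opprB -/d mulNr additive_charN.
    move: (chi (d * x)) (additive_char_neq0 (d * x)) => u u0.
    by field; rewrite !Q_neq0 u0.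
  by rewrite mulrACA (gauss_sum_norm g_neq0 ba0 gD) mulfVK.
- by rewrite mulmx1 mul1mx mulrC quad_basis_dual_entries.
- by rewrite mulmx1 mul1mx quad_basis_dual_entries.
by rewrite eqxx in ab.
Qed.

End GaussSums.

(** * Quadratic refinements of symmetric bicharacters in exponent two *)

Section QuadraticRefinement.
Variables (F : fieldType) (A : finZmodType) (B : A -> A -> F).
Hypothesis A2 : forall x : A, x + x = 0.
Hypothesis B_neq0 : forall x y, B x y != 0.
Hypothesis B_sym : forall x y, B x y = B y x.
Hypothesis BDl : forall x y z, B (x + y) z = B x z * B y z.
Hypothesis sqrtN1 : exists x : F, x ^+ 2 = -1.

Lemma bichar0 x : B 0 x = 1.
Proof. by apply: (mulfI (B_neq0 0 x)); rewrite -BDl addr0 mulr1. Qed.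

Lemma bichar_sqr x y : B x y * B x y = 1.
Proof. by rewrite -BDl A2 bichar0. Qed.

Lemma bicharDr x y z : B x (y + z) = B x y * B x z.
Proof. by rewrite B_sym BDl !(B_sym _ x). Qed.

(** Every element is its own opposite, so closure under sums makes [S] a subgroup. [Q] is nonzero
    everywhere, but its law is imposed on [S] only. *)
Definition quad_refines (S : {set A}) (Q : A -> F) : Prop :=
  [/\ 0 \in S, {in S &, forall x y, x + y \in S}, forall x, Q x != 0
    & {in S &, forall x y, Q (x + y) = Q x * Q y * B x y}].

(** Q extends to the coset e + S as soon as Q(e)^2 = B(e, e) = +-1 is solvable. *)
Lemma quad_refines_extend (S : {set A}) Q e :
  e \notin S -> quad_refines S Q ->
  exists2 S' : {set A}, (#|S| < #|S'|)%N & exists Q', quad_refines S' Q'.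
Proof.
move=> eS [S0 SD Q0 QD].
have addK x y : x + y + y = x :> A by rewrite -addrA A2 addr0.
have [s ss] : exists s : F, s * s = B e e.
  have := bichar_sqr e e; rewrite -expr2 => /eqP; rewrite sqrf_eq1.
  case/orP=> /eqP->; first by exists 1; rewrite mulr1.
  by have [i ii] := sqrtN1; exists i; rewrite -expr2.
have s0 : s != 0 by have := B_neq0 e e; rewrite -ss mulf_eq0 negb_or => /andP[].
have SDe x y : x \in S -> y \notin S -> x + y \notin S.
  by move=> xS; apply: contra => xyS; rewrite -(addK y x) addrC [y + x]addrC SD.
(* With [s] as the value at [e], the law forces [Q y * s * B y e] at [y + e]. The formula is used on
   the whole complement of [S], so [Q'] vanishes nowhere. *)
pose Q' x := if x \in S then Q x else s * Q (x + e) * B (x + e) e.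
have Q'e x : x \in S -> Q' (x + e) = s * Q x * B x e.
  by move=> xS; rewrite /Q' (negPf (SDe _ _ xS eS)) addK.
have Q'0 x : Q' x != 0 by rewrite /Q'; case: ifP => _; rewrite ?mulf_neq0.
have Q'S x : x \in S -> Q' x = Q x by rewrite /Q' => ->.
clearbody Q'.
pose S' := [set x | (x \in S) || (x + e \in S)].
have S'P x : x \in S' -> x \in S \/ exists2 y, y \in S & x = y + e.
  by rewrite inE => /orP[|xe]; [left | right; exists (x + e); rewrite ?addK].
have S'S x : x \in S -> x \in S' by rewrite inE => ->.
have S'e x : x \in S -> x + e \in S' by move=> xS; rewrite inE addK xS orbT.
have DeAC x y : x + e + y = x + y + e :> A by rewrite addrAC.
have DeACe x y : x + e + (y + e) = x + y :> A by rewrite addrA DeAC addK.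
exists S'.
  apply: proper_card; apply/properP; split; first by apply/subsetP=> x /S'S.
  by exists e => //; rewrite -[e]add0r S'e.
exists Q'; split.
- exact: S'S.
- move=> x y /S'P[xS|[x' xS ->]] /S'P[yS|[y' yS ->]]; rewrite ?DeACe ?DeAC ?addrA.
  + exact/S'S/SD.
  + exact/S'e/SD.
  + exact/S'e/SD.
  exact/S'S/SD.
- exact: Q'0.
have mixed x y : x \in S -> y \in S ->
  Q' (x + (y + e)) = Q' x * Q' (y + e) * B x (y + e).
  move=> xS yS. rewrite addrA (Q'S x) // !Q'e ?SD // QD // BDl bicharDr; ring.
move=> x y /S'P[xS|[x' xS ->]] /S'P[yS|[y' yS ->]].
- by rewrite !Q'S ?SD // QD.
- exact: mixed.
- by rewrite addrC mixed // B_sym [Q' y * _]mulrC.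
rewrite DeACe Q'S ?SD // !Q'e // QD // BDl !bicharDr (B_sym e y').
(* The factors involving [e] pair into squares of bicharacter values, all equal to 1, because
   [s * s] is [B e e]. *)
have -> : s * Q x' * B x' e * (s * Q y' * B y' e) *
          (B x' y' * B x' e * (B y' e * B e e)) =
          Q x' * Q y' * B x' y' *
          ((s * s * B e e) * (B x' e * B x' e) * (B y' e * B y' e)) by ring.
by rewrite ss !bichar_sqr !mulr1.
Qed.

(** Starting from the trivial subgroup, each extension strictly enlarges [S]; asking for more than
    [#|A|] elements leaves only the case where [S] is everything. *)
Lemma quad_refinement_exists :
  exists Q : A -> F, (forall x, Q x != 0) /\
    forall x y, Q (x + y) = Q x * Q y * B x y.
Proof.
have claim k : exists2 S : {set A},
  S = setT \/ (k <= #|S|)%N & exists Q, quad_refines S Q.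
  elim: k => [|k [S kS [Q refQ]]].
    exists [set 0]; first by right.
    exists (fun=> 1); split=> [|x y|x|x y]; rewrite ?inE ?oner_neq0 //.
      by move=> /eqP-> /eqP->; rewrite addr0.
    by move=> /eqP-> _; rewrite bichar0 !mulr1.
  have [ST|SnT] := eqVneq S setT; first by exists S; [left | exists Q].
  case: kS => [ST|kS]; first by rewrite ST eqxx in SnT.
  have [e eS] : exists e, e \notin S.
    apply/existsP; apply: contraR SnT => /existsPn SA.
    by apply/eqP/setP=> x; rewrite inE; apply/negPn.
  have [S' SS' refS'] := quad_refines_extend eS refQ.
  by exists S' => //; right; apply: leq_ltn_trans SS'.
have [S [-> [Q [_ _ Q0 QD]]|]] := claim #|A|.+1; last by rewrite ltnNge max_card.
by exists Q; split=> // x y; apply: QD; rewrite inE.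
Qed.

End QuadraticRefinement.

(** * Nontrivial additive characters and the assembly of the decomposition *)

Lemma additive_char_exists (F : fieldType) (K : finFieldType) p (z : F) :
  p \in [pchar K] -> p.-primitive_root z ->
  exists chi : K -> F, [/\ chi 0 = 1, forall x y, chi (x + y) = chi x * chi y
                         & exists x, chi x != 1].
Proof.
move=> pK zp; have p_pr := pcharf_prime pK.
pose R := pPrimeCharType pK.
pose b := vbasis (fullv : {vspace R}).
(* Over the prime field, the nonzero vector 1 has some nonzero coordinate; [z] raised to that
   coordinate is the character. *)
have [i bi] : exists i, coord b i (1 : R) != 0.
  apply/existsP; apply: contraT => /existsPn b0.
  have := coord_vbasis (memvf (1 : R)); rewrite big1 => [/eqP|i _].
    by rewrite oner_eq0.
  by have := b0 i; rewrite negbK => /eqP->; rewrite scale0r.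
exists (fun x : K => z ^+ (coord b i (x : R) : nat)); split.
- by rewrite linear0.
- move=> x y; rewrite [coord _ _ _]linearD /= -exprD.
  (* Coordinates add modulo [p], which is harmless in the exponent of a [p]-th root of unity. *)
  rewrite -[in RHS](prim_expr_mod zp); congr (z ^+ (_ %% _)).
  exact: Fp_cast.
exists 1; rewrite -(prim_order_dvd zp) gtnNdvd ?lt0n //.
by apply: leq_trans (ltn_ord _) _; rewrite Fp_cast.
Qed.

Theorem theorem2p1 (F : fieldType) (l p m : nat) :
  l \in [pchar F] -> l != 2%N -> l != 3%N -> l != p ->
  prime p -> (1 <= m)%N ->
  ((p == 2%N) /\ (exists x : F, x ^+ 2 = -1)
   \/ (2 < p)%N /\ (exists z : F, p.-primitive_root z)) ->
  COD F (p ^ m) l.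
Proof.
move=> lF l2 l3 lp p_pr m_gt0 Hp; have l_pr := pcharf_prime lF.
have nat_neq0 r : prime r -> l != r -> r%:R != 0 :> F.
  by move=> r_pr lr; rewrite -(dvdn_pcharf lF) dvdn_prime2.
have l_gt3 : (3 < l)%N.
  by have := prime_gt1 l_pr; case: l l2 l3 {lF lp l_pr nat_neq0} => [|[|[|[|]]]].
have [K pK cardK] := pPrimePowerField p_pr m_gt0.
have card_neq0 : #|K|%:R != 0 :> F by rewrite cardK natrX expf_neq0 ?nat_neq0.
have [z zp] : exists z : F, p.-primitive_root z.
  (* For [p = 2] the root is -1, primitive because the characteristic is not 2. *)
  case: Hp => [[/eqP-> _]|[_]//]; exists (-1); apply/andP; split=> //.
  apply/forallP=> [] [[|[|i]] //= _]; rewrite unity_rootE.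
    by rewrite expr1 neg1_neq1 // (nat_neq0 2%N).
  by rewrite sqrrN expr1n !eqxx.
have [chi [chi0 chiD chi_nt]] := additive_char_exists pK zp.
have chi_neq0 := additive_char_neq0 chi0 chiD.
have Q_ex (a : K) : exists Q : K -> F, (forall x, Q x != 0) /\
    forall x y, Q (x + y) = Q x * Q y * chi (a * x * y).
  case: Hp => [[/eqP p2 i_ex]|[p_gt2 _]].
    apply: (@quad_refinement_exists F K (fun x y => chi (a * x * y))) => //.
    - by rewrite p2 in pK => x; rewrite -mulr2n (mulrn_pchar pK).
    - by move=> x y; rewrite mulrAC.
    by move=> x y t; rewrite mulrDr mulrDl chiD.
  have two_neq0 : 2%:R != 0 :> K.
    by rewrite -(dvdn_pcharf pK) gtnNdvd.
  (* The cross term of [a * (x + y) ^+ 2 / 2] is exactly [a * x * y]. *)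
  exists (fun x => chi (a * x ^+ 2 / 2%:R)); split=> // x y.
  by rewrite -!chiD; congr chi; field.
have [Q HQ] := fin_all_exists Q_ex.
rewrite -cardK; apply: (@COD_of_unbiased F _ l (mub_basis chi Q) (mub_dual chi Q)) => //.
- by apply: mub_dualK => // a x; case: (HQ a).
- exact: nat_neq0.
- exact: nat_neq0.
by apply: mub_unbiased => // a; case: (HQ a).
Qed.
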